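(* Let $m\ge1$, $\lambda>0$, let $M,N\ge0$ be integers and $K=\max\{M,N\}$. Let $\mathcal U,\mathcal V$ be positive definite linear functionals with respective sequences of monic orthogonal polynomials $\{P_n\}_{n\ge0}$, $\{Q_n\}_{n\ge0}$, and let $\{S_n(x;\lambda,\nu)\}_{n\ge0}$ be the sequence of monic orthogonal polynomials with respect to the Sobolev inner product $$\langle p,r\rangle_{\lambda,\nu}=\langle\mathcal U,p(x)r(x)\rangle+\lambda\langle\mathcal V,(D_\nu^mp)(x)(D_\nu^mr)(x)\rangle .$$ Suppose that $(\mathcal U,\mathcal V)$ is a $(M,N)$-$D_\nu$-coherent pair of order $m$, i.e. $$P^{[m,\nu]}_{n}(x)+\sum_{i=1}^Ma_{i,n}P^{[m,\nu]}_{n-i}(x)=Q_n(x)+\sum_{i=1}^Nb_{i,n}Q_{n-i}(x),\qquad n\ge0,$$ where $a_{M,n}\ne0$ if $n\ge M$, $b_{N,n}\ne0$ if $n\ge N$, and $a_{i,n}=b_{i,n}=0$ if $i>n$. Then $S_n(x;\lambda,\nu)=P_n(x)$ for $n<m$, and $$P_{n+m}(x)+\sum_{i=1}^M\frac{\eta_{n,m,\nu}\,a_{i,n}}{\eta_{n-i,m,\nu}}P_{n-i+m}(x)=S_{n+m}(x;\lambda,\nu)+\sum_{j=1}^Kc_{j,n,\lambda,\nu}\,S_{n-j+m}(x;\lambda,\nu),\qquad n\ge0,\qquad(\ast)$$ where $c_{j,n,\lambda,\nu}=0$ for $n<j\le K$, and for $1\le j\le K$ $$c_{j,n,\lambda,\nu}=\frac{\eta_{n,m,\nu}}{\langle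 S_{n-j+m},S_{n-j+m}\rangle_{\lambda,\nu}}\Bigg[\sum_{i=j}^M\frac{a_{i,n}}{\eta_{n-i,m,\nu}}\langle\mathcal U,P_{n-i+m}(x)S_{n-j+m}(x;\lambda,\nu)\rangle+\lambda\sum_{i=j}^Nb_{i,n}\langle\mathcal V,Q_{n-i}(x)D_\nu^m[S_{n-j+m}(x;\lambda,\nu)]\rangle\Bigg].$$ Besides, for each $n\ge K$: (i) if $M>N$ and $a_{M,n}\ne0$, then $c_{K,n,\lambda,\nu}\ne0$; (ii) if $M<N$ and $b_{N,n}\ne0$, then $c_{K,n,\lambda,\nu}\ne0$; (iii) if $M=N\,(=K)$ and $a_{M,n}b_{N,n}\ne0$, then $c_{K,n,\lambda,\nu}\ne0$ if and only if $$a_{K,n}\langle\mathcal U,P_{n-K+m}^2(x)\rangle+\lambda\,\eta_{n-K,m,\nu}^2\,b_{K,n}\langle\mathcal V,Q_{n-K}^2(x)\rangle\ne0.$$ Conversely, for positive definite $\mathcal U,\mathcal V$ (not assumed to be a coherent pair), if there exist constants $\{c_{j,n,\lambda,\nu}\}_{n\ge0}$, $1\le j\le K$, and $\{a_{i,n}\}_{n\ge0}$, $1\le i\le M$, with $c_{j,n,\lambda,\nu}=0$ whenever $n-j+m<0$ and $a_{i,n}=0$ whenever $i>n$, such that $(\ast)$ holds for all $n\ge0$, then $$P^{[m,\nu]}_{n}(x)+\sum_{i=1}^Ma_{i,n}P^{[m,\nu]}_{n-i}(x)=Q_n(x)+\sum_{j=1}^Kb_{j,n}Q_{n-j}(x),\qquad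 n\ge0,$$ where $b_{j,n}=0$ for $n<j\le K$ and, for $n\ge0$ and $1\le j\le\min\{K,n\}$, $$b_{j,n}=\frac{\Big\langle\mathcal V,\Big(P^{[m,\nu]}_{n}(x)+\sum_{i=1}^Ma_{i,n}P^{[m,\nu]}_{n-i}(x)\Big)Q_{n-j}(x)\Big\rangle}{\langle\mathcal V,Q_{n-j}^2(x)\rangle};$$ thus $(\mathcal U,\mathcal V)$ is a $(M,K)$-$D_\nu$-coherent pair of order $m$ whenever $b_{K,n}\ne0$ for $n\ge K$ (and $a_{M,n}\neq 0$ for $n\ge M$).
   Context: $\mathbb{P}$ is the space of polynomials with real coefficients; linear functionals are real linear maps on $\mathbb{P}$, and $\langle\mathcal U,p\rangle$ is the value of $\mathcal U$ at $p$. $\nu$ is either $\omega\in\mathbb{R}\setminus\{0\}$, with $D_\omega p(x)=\frac{p(x+\omega)-p(x)}{\omega}$, or $q\in\mathbb{R}\setminus\{0,\pm1\}$, with $D_qp(x)=\frac{p(qx)-p(x)}{(q-1)x}$ (the statement covers both cases). $D_\nu^m$ is the $m$-th iterate. A functional $\mathcal U$ with moments $u_n=\langle\mathcal U,x^n\rangle$ is positive definite if $\det[u_{i+j}]_{i,j=0}^n>0$ for all $n\ge0$. Its sequence of monic orthogonal polynomials (SMOP) is the sequence of monic $P_n$, $\deg P_n=n$, with $\langle\mathcal U,P_nP_k\rangle=\xi_n\delta_{n,k}$, $\xi_n\ne0$. The SMOP with respect to $\langle\cdot,\cdot\rangle_{\lambda,\nu}$ is defined analogously. $$P^{[m,\nu]}_{n}(x):=\frac{D_\nu^mP_{n+m}(x)}{\eta_{n,m,\nu}},\qquad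 \eta_{n,m,\omega}:=(n+1)(n+2)\cdots(n+m),\qquad \eta_{n,m,q}:=\frac{\prod_{i=1}^{m}(1-q^{n+i})}{(1-q)^m}.$$ A pair $(\mathcal U,\mathcal V)$ is a $(M,N)$-$D_\nu$-coherent pair of order $m$ if $P^{[m,\nu]}_{n}+\sum_{i=1}^Ma_{i,n}P^{[m,\nu]}_{n-i}=Q_n+\sum_{i=1}^Nb_{i,n}Q_{n-i}$ for $n\ge0$ with constants satisfying $a_{M,n}\ne0$ for $n\ge M$, $b_{N,n}\ne0$ for $n\ge N$, and $a_{i,n}=b_{i,n}=0$ for $i>n$. Conventions: $a_{0,n}=b_{0,n}=c_{0,n,\lambda,\nu}=1$; every term containing a coefficient $a_{i,n}$ or $b_{i,n}$ with $i>n$ is zero (even if the accompanying $\eta_{n-i,m,\nu}$ vanishes or $Q_{n-i}$, $P_{n-i}^{[m,\nu]}$ has negative index), and the formula for $c_{j,n,\lambda,\nu}$ is to be used for $j\le n$ (for $n<j\le K$, $c_{j,n,\lambda,\nu}=0$). *)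

(* Defs.v *)
From HB Require Import structures.
From mathcomp Require Import all_boot all_order all_algebra.
From mathcomp Require Import reals.

Set Implicit Arguments.
Unset Strict Implicit.
Unset Printing Implicit Defensive.

Import Order.TTheory GRing.Theory Num.Theory.
Local Open Scope ring_scope.

Inductive step (R : realType) := Shift of R | Dilation of R.

Definition admissible (R : realType) (nu : step R) : Prop :=
  match nu with
  | Shift w => w != 0
  | Dilation q => [/\ q != 0, q != 1 & q != -1]
  end.

(* In the dilation case the polynomial quotient is exact, see [Dnu_dilationE] *)
Definition Dnu (R : realType) (nu : step R) (p : {poly R}) : {poly R} :=
  match nu with
  | Shift w => w^-1 *: (p \Po ('X + w%:P) - p)
  | Dilation q => (p \Po (q *: 'X) - p) %/ ((q - 1) *: 'X)
  end.

Definition Diter (R : realType) (nu : step R) (m : nat) (p : {poly R}) :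
  {poly R} := iter m (Dnu nu) p.

Lemma Dnu_dilationE (R : realType) (q : R) (p : {poly R}) : q != 1 ->
  Dnu (Dilation q) p * ((q - 1) *: 'X) = p \Po (q *: 'X) - p.
Proof.
move=> q1; rewrite /Dnu divpK // dvdpZl ?subr_eq0 //.
rewrite -['X]subr0 -polyC0 dvdp_XsubCl /root !hornerE horner_comp !hornerE.
by rewrite oppr0 mulr0 subrr.
Qed.

Definition eta_nu (R : realType) (nu : step R) (m n : nat) : R :=
  match nu with
  | Shift _ => \prod_(1 <= i < m.+1) (n + i)%N%:R
  | Dilation q => (\prod_(1 <= i < m.+1) (1 - q ^+ (n + i)%N)) / (1 - q) ^+ m
  end.

Definition posdef (R : realType) (U : {scalar {poly R}}) : Prop :=
  forall n : nat, 0 < \det (\matrix_(i < n.+1, j < n.+1) U ('X^(i + j)%N)).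

Definition smop (R : realType) (B : {poly R} -> {poly R} -> R)
    (P : nat -> {poly R}) : Prop :=
  (forall n, P n \is monic /\ size (P n) = n.+1) /\
  exists xi : nat -> R,
    (forall n, xi n != 0) /\
    (forall n k, B (P n) (P k) = if n == k then xi n else 0).

Definition functional_form (R : realType) (U : {scalar {poly R}})
    (p r : {poly R}) : R := U (p * r).

Definition sobolev (R : realType) (nu : step R) (m : nat) (lam : R)
    (U V : {scalar {poly R}}) (p r : {poly R}) : R :=
  U (p * r) + lam * V (Diter nu m p * Diter nu m r).

(* The polynomial P^{[m,nu]}_n *)
Definition Pder (R : realType) (nu : step R) (m : nat) (P : nat -> {poly R})
    (n : nat) : {poly R} :=
  (eta_nu nu m n)^-1 *: Diter nu m (P (n + m)%N).

(* The entry [a i n] is a_{i,n}; entries with [L < i] are never used.  Since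
   a_{i,n} = 0 for n < i, truncated differences [n - i] are harmless in any
   term carrying such a coefficient. *)
Definition coef_array (R : realType) (L : nat) (a : nat -> nat -> R) : Prop :=
  (forall n, a 0%N n = 1) /\
  (forall i n, (i <= L)%N -> (n < i)%N -> a i n = 0).

Definition coherence_relation (R : realType) (nu : step R) (m M N : nat)
    (P Q : nat -> {poly R}) (a b : nat -> nat -> R) : Prop :=
  forall n : nat,
    Pder nu m P n + \sum_(1 <= i < M.+1) a i n *: Pder nu m P (n - i)%N =
    Q n + \sum_(1 <= i < N.+1) b i n *: Q (n - i)%N.

Definition coherent_by (R : realType) (nu : step R) (m M N : nat)
    (P Q : nat -> {poly R}) (a b : nat -> nat -> R) : Prop :=
  [/\ coef_array M a, coef_array N b,
      forall n, (M <= n)%N -> a M n != 0,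
      forall n, (N <= n)%N -> b N n != 0
    & coherence_relation nu m M N P Q a b].

Definition coherent_pair (R : realType) (nu : step R) (m M N : nat)
    (U V : {scalar {poly R}}) : Prop :=
  exists P Q : nat -> {poly R}, exists a b : nat -> nat -> R,
    [/\ smop (functional_form U) P, smop (functional_form V) Q
      & coherent_by nu m M N P Q a b].

(* On the right the index is [n + m - j], not [n - j + m]: when n < j <= n + m
   the polynomial S_{n+m-j} exists and c_{j,n} is not assumed to vanish. *)
Definition sobolev_relation (R : realType) (nu : step R) (m M K : nat)
    (P S : nat -> {poly R}) (a c : nat -> nat -> R) : Prop :=
  forall n : nat,
    P (n + m)%N + \sum_(1 <= i < M.+1)
      (eta_nu nu m n * a i n / eta_nu nu m (n - i)) *: P (n - i + m)%N =
    S (n + m)%N + \sum_(1 <= j < K.+1) c j n *: S (n + m - j)%N.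

Definition sobolev_coef (R : realType) (nu : step R) (m : nat) (lam : R)
    (M N : nat) (U V : {scalar {poly R}}) (P Q S : nat -> {poly R})
    (a b : nat -> nat -> R) (j n : nat) : R :=
  if j == 0%N then 1
  else if (j <= n)%N then
    let Sj := S (n - j + m)%N in
    eta_nu nu m n / sobolev nu m lam U V Sj Sj *
    (\sum_(j <= i < M.+1)
        a i n / eta_nu nu m (n - i) * U (P (n - i + m)%N * Sj)
     + lam * \sum_(j <= i < N.+1) b i n * V (Q (n - i)%N * Diter nu m Sj))
  else 0.

Definition coherence_coef (R : realType) (nu : step R) (m M : nat)
    (V : {scalar {poly R}}) (P Q : nat -> {poly R})
    (a : nat -> nat -> R) (j n : nat) : R :=
  if j == 0%N then 1
  else if (j <= n)%N then
    V ((Pder nu m P n + \sum_(1 <= i < M.+1) a i n *: Pder nu m P (n - i)%N)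
       * Q (n - j)%N)
    / V (Q (n - j)%N ^+ 2)
  else 0.

(* Main.v *)
(** Let F_n be the left-hand side of the Sobolev relation. The weights
    eta_n / eta_(n-i) are chosen so that D^m F_n = eta_n G_n, where G_n is the
    left-hand side of the coherence relation; hence, for every polynomial r,
      <F_n, r> = U(F_n r) + lam eta_n V(G_n D^m r).
    The first term vanishes when deg r < n + m - M, by orthogonality of the P_k.
    The coherence relation with N terms makes the second one vanish when
    deg r < n + m - N, so only the last K + 1 coefficients of F_n in the basis
    S_k survive. Conversely, if F_n has this banded expansion, the identity
    with r = P_(k+m) gives V(G_n P^[m]_k) = 0 for k < n - K; the P^[m]_k being
    a basis, G_n is orthogonal to all polynomials of degree < n - K. *)
Require Import Defs.
From HB Require Import structures.
From mathcomp Require Import all_boot all_order all_algebra.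
From mathcomp Require Import reals.
From mathcomp Require Import zify ring.

Set Implicit Arguments.
Unset Strict Implicit.
Unset Printing Implicit Defensive.

Import Order.TTheory GRing.Theory Num.Theory.
Local Open Scope ring_scope.

(** * The operators D_nu and D_nu^m: linearity, leading coefficients, degrees *)

Arguments Dnu : simpl never.

Lemma Dnu_is_linear (R : realType) (nu : step R) : linear (Dnu nu).
Proof.
rewrite /Dnu; case: nu => [w|q] c p r.
  rewrite comp_polyD comp_polyZ opprD addrACA -scalerBr scalerDr !scalerA.
  by rewrite mulrC.
rewrite comp_polyD comp_polyZ opprD addrACA -scalerBr.
by rewrite divpD divpZl.
Qed.

HB.instance Definition _ (R : realType) (nu : step R) :=
  GRing.isLinear.Build R {poly R} {poly R} *:%R (Dnu nu) (Dnu_is_linear nu).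

Lemma Diter_is_linear (R : realType) (nu : step R) (m : nat) :
  linear (Diter nu m).
Proof.
by elim: m => [|m IHm] c p r //; rewrite /Diter /= [iter m _ _]IHm linearP.
Qed.

HB.instance Definition _ (R : realType) (nu : step R) (m : nat) :=
  GRing.isLinear.Build R {poly R} {poly R} *:%R (Diter nu m)
    (Diter_is_linear nu m).

(** The scalar by which D_nu multiplies the leading coefficient in degree n: n itself for shifts,
    the q-number [n]_q for dilations. *)
Definition Dnu_factor (R : realType) (nu : step R) (n : nat) : R :=
  match nu with
  | Shift _ => n%:R
  | Dilation q => (1 - q ^+ n) / (1 - q)
  end.

(** Over the reals q^n = 1 with n > 0 forces |q| = 1, and both q = 1 and q = -1 are excluded. *)
Lemma Dnu_factor_neq0 (R : realType) (nu : step R) (n : nat) :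
  admissible nu -> (0 < n)%N -> Dnu_factor nu n != 0.
Proof.
case: nu => [w|q] /= adm n_gt0; first by rewrite pnatr_eq0 -lt0n.
case: adm => q0 q1 qN1.
rewrite mulf_neq0 ?invr_eq0 // subr_eq0 eq_sym //.
apply/eqP => /(congr1 Num.norm); rewrite normrX normr1 => /eqP.
rewrite pexpr_eq1 // => /eqP; case: (ger0P q) => _ E.
  by rewrite E eqxx in q1.
by rewrite -E opprK eqxx in qN1.
Qed.

Lemma eta_nuE (R : realType) (nu : step R) (m n : nat) :
  eta_nu nu m n = \prod_(1 <= i < m.+1) Dnu_factor nu (n + i).
Proof.
case: nu => [//|q] /=.
rewrite big_split /= prodr_const_nat subn1 /= exprVn.
by congr (_ / _).
Qed.

Lemma eta_nu_neq0 (R : realType) (nu : step R) (m n : nat) :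
  admissible nu -> eta_nu nu m n != 0.
Proof.
move=> adm; rewrite eta_nuE prodf_seq_neq0; apply/allP => i.
rewrite mem_index_iota => /andP[i0 _]; apply/implyP => _.
by rewrite Dnu_factor_neq0 // ltn_addl.
Qed.

(** These are the terms of ((X + w)^n - X^n) / w. Each has coefficient 1 in degree n - 1, so their
    sum has coefficient n there. *)
Lemma shift_term_monic (R : realType) (w : R) (n : nat) (i : 'I_n) :
  let r := ('X + w%:P) ^+ (n.-1 - i) * 'X^i in r \is monic /\ size r = n.
Proof.
have mon : ('X + w%:P) ^+ (n.-1 - i) \is monic by rewrite monic_exp ?monicXaddC.
split; first by rewrite monicMr ?monicXn.
rewrite size_monicM ?monic_neq0 ?monicXn // size_polyXn.
have := size_exp_XsubC (n.-1 - i) (- w); rewrite polyCN opprK => ->.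
by have := ltn_ord i; lia.
Qed.

Lemma shift_quotientXn (R : realType) (w : R) (n : nat) : w != 0 ->
  Dnu (Shift w) 'X^n = \sum_(i < n) ('X + w%:P) ^+ (n.-1 - i) * 'X^i.
Proof.
move=> w0; rewrite /Dnu comp_Xn_poly subrXX.
rewrite addrAC subrr add0r mul_polyC scalerA mulVf // scale1r.
by apply: eq_bigr => i _; congr (_ ^+ _ * _); lia.
Qed.

(** The size bound makes X^(k+1) the highest possible monomial of [p]; under a shift, higher
    monomials would also contribute to X^k. *)
Lemma coef_Dnu (R : realType) (nu : step R) (p : {poly R}) (k : nat) :
  admissible nu -> (size p <= k.+2)%N ->
  (Dnu nu p)`_k = Dnu_factor nu k.+1 * p`_k.+1.
Proof.
case: nu => [w|q] adm size_p.
  rewrite [in LHS](_ : p = \sum_(i < k.+2) p`_i *: 'X^i); last first.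
    by rewrite -poly_def; apply/polyP => i; rewrite coef_poly;
      case: ltnP => // ?; rewrite nth_default // (leq_trans size_p).
  (* Monomials below X^(k+1) have difference quotients of degree below k; the top one gives k + 1
     terms, each contributing 1. *)
  rewrite linear_sum coef_sum big_ord_recr big1 /= => [|i _].
    rewrite add0r linearZ /= coefZ shift_quotientXn // coef_sum mulrC.
    congr (_ * _); rewrite -[k.+1 in RHS]card_ord -sumr_const.
    apply: eq_bigr => i _; have [mon sz] := shift_term_monic w i.
    by move/monicP: mon; rewrite lead_coefE sz.
  rewrite linearZ /= coefZ shift_quotientXn // coef_sum big1 ?mulr0 // => j _.
  have [_ sz] := shift_term_monic w j.
  by rewrite nth_default // sz -ltnS.
case: adm => q0 q1 qN1.
have q1' : q - 1 != 0 by rewrite subr_eq0.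
(* Coefficients of X^(k+1) are compared in the exact identity (q - 1) X D_q p = p(qX) - p. *)
have /(congr1 (fun r : {poly R} => r`_k.+1)) := Dnu_dilationE p q1.
rewrite -scalerAr coefZ coefMX /= coefB comp_polyE coef_sum => E.
have comp_coef : (\sum_(i < size p) (p`_i *: (q *: 'X) ^+ i)`_k.+1)
    = p`_k.+1 * q ^+ k.+1.
  under eq_bigr => i _ do
    rewrite exprZn coefZ coefZ coefXn.
  case: (ltnP k.+1 (size p)) => sz.
    rewrite (bigD1 (Ordinal sz)) //= eqxx mulr1 big1 ?addr0 // => i ne.
    have -> : (k.+1 == i) = false.
      by apply: contraNF ne => /eqP E'; apply/eqP/val_inj.
    by rewrite !mulr0.
  rewrite big1 => [|i _]; first by rewrite nth_default // mul0r.
  have -> : (k.+1 == i) = false.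
    by apply/negbTE; rewrite neq_ltn (leq_trans (ltn_ord i) sz) orbT.
  by rewrite !mulr0.
rewrite comp_coef in E; apply: (mulfI q1'); rewrite E /Dnu_factor.
have q1'' : 1 - q != 0 by rewrite subr_eq0 eq_sym.
by field.
Qed.

Lemma coef_Diter (R : realType) (nu : step R) (m : nat) (p : {poly R})
    (k : nat) : admissible nu -> (size p <= (k + m).+1)%N ->
  (Diter nu m p)`_k = eta_nu nu m k * p`_(k + m).
Proof.
move=> adm; rewrite eta_nuE.
elim: m k => [|m IHm] k size_p; first by rewrite big_geq // mul1r addn0.
(* The degree bound for D^m p is the induction hypothesis itself, read at all higher
   coefficients. *)
have size_D : (size (Diter nu m p) <= k.+2)%N.
  apply/leq_sizeP => j k_lt_j.
  rewrite IHm ?[p`__]nth_default ?mulr0 //; apply: leq_trans size_p _; lia.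
rewrite /Diter iterS coef_Dnu // IHm; last by apply: leq_trans size_p _; lia.
rewrite mulrA addSnnS; congr (_ * _).
rewrite [RHS]big_nat_recl // addn1; congr (_ * _).
by apply: eq_big_nat => i _; rewrite addSnnS.
Qed.

Lemma size_Diter (R : realType) (nu : step R) (m : nat) (p : {poly R}) :
  admissible nu -> (size (Diter nu m p) <= size p - m)%N.
Proof.
move=> adm; apply/leq_sizeP => j size_le.
have size_le' : (size p <= j + m)%N by rewrite addnC -leq_subLR.
by rewrite coef_Diter ?[p`__]nth_default ?mulr0 // leqW.
Qed.

Lemma Pder_monic (R : realType) (nu : step R) (m : nat)
    (P : nat -> {poly R}) (n : nat) : admissible nu ->
  (forall k, P k \is monic /\ size (P k) = k.+1) ->
  Pder nu m P n \is monic /\ size (Pder nu m P n) = n.+1.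
Proof.
move=> adm monP; have [/monicP mon sz] := monP (n + m)%N.
have lead : (Pder nu m P n)`_n = 1.
  rewrite /Pder coefZ coef_Diter ?sz //.
  by rewrite mulrA mulVf ?eta_nu_neq0 // mul1r -mon lead_coefE sz.
have size_le : (size (Pder nu m P n) <= n.+1)%N.
  rewrite /Pder; apply: leq_trans (size_scale_leq _ _) _.
  by apply: leq_trans (size_Diter _ _ adm) _; rewrite sz; lia.
have size_eq : size (Pder nu m P n) = n.+1.
  apply/eqP; rewrite eqn_leq size_le ltnNge; apply/negP => /leq_sizeP le.
  by move: lead; rewrite le // => /eqP; rewrite eq_sym oner_eq0.
by split=> //; apply/monicP; rewrite lead_coefE size_eq.
Qed.

(** * Triangular bases and expansions in orthogonal polynomials *)

(** Induction on the degree bound: subtracting a suitable multiple of [B n] cancels the coefficient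
    of X^n. *)
Lemma span_triangular (F : fieldType) (B : nat -> {poly F}) :
  (forall n, size (B n) = n.+1) ->
  forall (n : nat) (p : {poly F}), (size p <= n)%N ->
  exists d : nat -> F, p = \sum_(k < n) d k *: B k.
Proof.
move=> sizeB; elim=> [|n IHn] p size_p.
  by exists (fun=> 0); rewrite big_ord0; apply/eqP; rewrite -size_poly_leq0.
have lead : (B n)`_n != 0.
  have := lead_coef_eq0 (B n); rewrite lead_coefE sizeB /= => ->.
  by rewrite -size_poly_gt0 sizeB.
pose e := p`_n / (B n)`_n.
have [|d Ed] := IHn (p - e *: B n).
  apply/leq_sizeP => j; rewrite leq_eqVlt => /predU1P[<-|n_lt_j].
    by rewrite coefB coefZ divfK // subrr.
  rewrite coefB coefZ !nth_default ?mulr0 ?subr0 ?sizeB //.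
  exact: leq_trans size_p _.
exists (fun k => if (k < n)%N then d k else e).
rewrite big_ord_recr /= ltnn -[LHS](subrK (e *: B n)) Ed; congr (_ + _).
by apply: eq_bigr => k _; rewrite ltn_ord.
Qed.

Lemma linear_form_triangular0 (F : fieldType) (B : nat -> {poly F})
    (f : {scalar {poly F}}) (n : nat) (p : {poly F}) :
  (forall k, size (B k) = k.+1) -> (forall k, (k < n)%N -> f (B k) = 0) ->
  (size p <= n)%N -> f p = 0.
Proof.
move=> sizeB f0 size_p; have [d ->] := span_triangular sizeB size_p.
rewrite linear_sum big1 // => k _.
by rewrite linearZ /= f0 ?mulr0.
Qed.

Lemma smop_norm_neq0 (R : realType) (B : {poly R} -> {poly R} -> R)
    (P : nat -> {poly R}) (n : nat) : smop B P -> B (P n) (P n) != 0.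
Proof. by case=> _ [xi [xi0 E]]; rewrite E eqxx. Qed.

Lemma smop_pairing0 (R : realType) (B : {poly R} -> {poly R} -> R)
    (P : nat -> {poly R}) (n k : nat) :
  smop B P -> n != k -> B (P n) (P k) = 0.
Proof. by case=> _ [xi [_ E]] /negbTE ne; rewrite E ne. Qed.

Lemma smop_monic (R : realType) (B : {poly R} -> {poly R} -> R)
    (P : nat -> {poly R}) (n : nat) : smop B P -> P n \is monic.
Proof. by case=> /(_ n)[]. Qed.

Lemma smop_size (R : realType) (B : {poly R} -> {poly R} -> R)
    (P : nat -> {poly R}) (n : nat) : smop B P -> size (P n) = n.+1.
Proof. by case=> /(_ n)[]. Qed.

Lemma smop_expand (R : realType) (B : {poly R} -> {poly R} -> R)
    (P : nat -> {poly R}) (n : nat) (p : {poly R}) :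
  (forall r, scalar (B r)) -> smop B P -> (size p <= n)%N ->
  p = \sum_(k < n) (B (P k) p / B (P k) (P k)) *: P k.
Proof.
move=> linB smopP size_p.
have [d Ed] := span_triangular (fun k => smop_size k smopP) size_p.
rewrite [LHS]Ed; apply: eq_bigr => k _; congr (_ *: _).
(* [B (P k)] is bundled as a linear form so that the expansion can be paired with [P k] term by
   term. *)
have [f Ef] : exists f : {scalar {poly R}}, f =1 B (P k).
  by exists (HB.pack_for {scalar {poly R}} (B (P k))
    (GRing.isLinear.Build R {poly R} R *%R _ (linB (P k)))).
have -> : B (P k) p = d k * B (P k) (P k).
  rewrite -Ef Ed linear_sum (bigD1 k) //= big1 => [|j ne].
    by rewrite linearZ /= Ef addr0.
  rewrite linearZ /= Ef (smop_pairing0 smopP) ?mulr0 //.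
  by rewrite eq_sym; apply: contra_neq ne; apply: val_inj.
by rewrite mulfK ?(smop_norm_neq0 _ smopP).
Qed.

(** Only [P n] reaches degree n in the expansion, so comparing coefficients of X^n identifies its
    Fourier coefficient. *)
Lemma smop_pairing (R : realType) (B : {poly R} -> {poly R} -> R)
    (P : nat -> {poly R}) (n : nat) (p : {poly R}) :
  (forall r, scalar (B r)) -> smop B P -> (size p <= n.+1)%N ->
  B (P n) p = p`_n * B (P n) (P n).
Proof.
move=> linB smopP size_p.
have lead : (P n)`_n = 1.
  by have /monicP := smop_monic n smopP; rewrite lead_coefE (smop_size _ smopP).
have /(congr1 (fun r : {poly R} => r`_n)) /= := smop_expand linB smopP size_p.
rewrite coef_sum big_ord_recr big1 /= => [|k _]; last first.
  by rewrite coefZ nth_default ?mulr0 // (smop_size _ smopP).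
rewrite add0r coefZ lead mulr1 => ->.
by rewrite divfK ?(smop_norm_neq0 _ smopP).
Qed.

(* For [n < j] truncation turns [P (n - j)] into [P 0], whence the last
   hypothesis. *)
Lemma smop_band (R : realType) (B : {poly R} -> {poly R} -> R)
    (P : nat -> {poly R}) (K n : nat) (p : {poly R}) (c : nat -> R) :
  (forall r, scalar (B r)) -> smop B P -> p \is monic -> size p = n.+1 ->
  (forall k, (k + K < n)%N -> B (P k) p = 0) ->
  (forall j, (1 <= j <= K)%N -> (j <= n)%N ->
     c j * B (P (n - j)%N) (P (n - j)%N) = B (P (n - j)%N) p) ->
  (forall j, (1 <= j <= K)%N -> (n < j)%N -> c j = 0) ->
  p = P n + \sum_(1 <= j < K.+1) c j *: P (n - j)%N.
Proof.
move=> linB smopP mon_p size_p orth c_eq c0.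
have nz k := smop_norm_neq0 k smopP.
rewrite [LHS](smop_expand linB smopP (n := n.+1)) ?size_p //.
rewrite -(big_mkord xpredT (fun k => (B (P k) p / B (P k) (P k)) *: P k)).
(* The Fourier expansion is reversed, so that its leading term splits off, with coefficient 1
   because [p] is monic. *)
rewrite big_nat_rev big_nat_recl //=; congr (_ + _).
  rewrite add0n subSS subn0 (smop_pairing linB smopP) ?size_p //.
  move: mon_p; rewrite monicE lead_coefE size_p /= => /eqP ->.
  by rewrite mul1r divff // scale1r.
rewrite [RHS]big_add1 /=.
under eq_bigr => j _ do rewrite add0n subSS.
(* The Fourier terms, extended by zero past n. The sums of lengths n and K are both compared with
   one of length n + K. *)
pose g j := if (j < n)%N then
  (B (P (n - j.+1)%N) p / B (P (n - j.+1)%N) (P (n - j.+1)%N))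
    *: P (n - j.+1)%N else 0.
transitivity (\sum_(0 <= j < n + K) g j).
  rewrite [RHS](big_cat_nat _ (n := n)) ?leq_addr //= [X in _ + X]big1_seq.
    by rewrite addr0; apply: eq_big_nat => j /andP[_ jn]; rewrite /g jn.
  move=> j /andP[_]; rewrite mem_index_iota => /andP[nj _].
  by rewrite /g ltnNge nj.
(* Terms with [K <= j] vanish by [orth]; the others match by [c_eq] or, past n, by the vanishing of
   [c]. *)
rewrite (big_cat_nat _ (n := K)) ?leq_addl //= [X in _ + X]big1_seq ?addr0.
  apply: eq_big_nat => j /andP[_ jK]; rewrite /g; case: ltnP => jn.
    by rewrite -c_eq // mulfK.
  by rewrite c0 ?scale0r.
move=> j /andP[_]; rewrite mem_index_iota /g => /andP[Kj _].
by case: ltnP => // jn; rewrite orth ?mul0r ?scale0r //; lia.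
Qed.

(** * Banded combinations and their pairings *)

(** The term i = 0 is kept inside the sum, with coefficient 1 for a [coef_array], so that pairings
    treat all terms alike. *)
Definition banded (R : realType) (L : nat) (a : nat -> nat -> R)
    (Q : nat -> {poly R}) (n : nat) : {poly R} :=
  \sum_(0 <= i < L.+1) a i n *: Q (n - i)%N.

Lemma bandedE (R : realType) (L : nat) (a : nat -> nat -> R)
    (Q : nat -> {poly R}) (n : nat) : coef_array L a ->
  banded L a Q n = Q n + \sum_(1 <= i < L.+1) a i n *: Q (n - i)%N.
Proof.
by case=> a0 _; rewrite /banded big_ltn // a0 scale1r subn0.
Qed.

(** The terms i >= 1 have lower degree; where truncation would repeat [Q 0], the coefficient
    vanishes. The degree shift [m] covers F_n and, when it is 0, G_n. *)
Lemma banded_monic (R : realType) (L m : nat) (a : nat -> nat -> R)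
    (Q : nat -> {poly R}) (n : nat) : coef_array L a ->
  (forall k, Q k \is monic /\ size (Q k) = (k + m).+1) ->
  banded L a Q n \is monic /\ size (banded L a Q n) = (n + m).+1.
Proof.
move=> arr monQ; have [mon sz] := monQ n; have [_ a0] := arr.
have small :
    (size (\sum_(1 <= i < L.+1) a i n *: Q (n - i)%N)%R < size (Q n))%N.
  rewrite sz ltnS big_nat; apply: (leq_trans (size_sum _ _ _)).
  apply/bigmax_leqP_seq => i _ /andP[i_ge1 i_le].
  case: (ltnP n i) => ni; first by rewrite a0 // scale0r size_poly0.
  by apply: leq_trans (size_scale_leq _ _) _; rewrite (monQ _).2; lia.
rewrite bandedE //; split; last by rewrite size_polyDl.
by rewrite monicE lead_coefDl // -monicE.
Qed.

Lemma functional_form_scalar (R : realType) (U : {scalar {poly R}})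
    (p : {poly R}) : scalar (functional_form U p).
Proof. by move=> c u v; rewrite /functional_form mulrDr -scalerAr linearP. Qed.

HB.instance Definition _ (R : realType) (U : {scalar {poly R}})
    (p : {poly R}) :=
  GRing.isLinear.Build R {poly R} R *%R (functional_form U p)
    (functional_form_scalar U p).

Lemma functional_pairing (R : realType) (U : {scalar {poly R}})
    (P : nat -> {poly R}) (n : nat) (r : {poly R}) :
  smop (functional_form U) P -> (size r <= n.+1)%N ->
  U (P n * r) = r`_n * U (P n ^+ 2).
Proof. exact: (smop_pairing (functional_form_scalar U)). Qed.

Lemma functional_pairing0 (R : realType) (U : {scalar {poly R}})
    (P : nat -> {poly R}) (n : nat) (r : {poly R}) :
  smop (functional_form U) P -> (size r <= n)%N -> U (P n * r) = 0.
Proof.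
move=> smopP size_r.
by rewrite functional_pairing ?nth_default ?mul0r // leqW.
Qed.

(** A term with i < j carries P_(n-i+m), whose degree exceeds that of [r], so orthogonality removes
    it. *)
Lemma banded_pairing (R : realType) (U : {scalar {poly R}}) (L m : nat)
    (a : nat -> nat -> R) (P Q : nat -> {poly R}) (j n : nat) (r : {poly R}) :
  smop (functional_form U) P -> (forall k, Q k = P (k + m)%N) -> (j <= n)%N ->
  (size r <= (n - j + m).+1)%N ->
  U (banded L a Q n * r) = \sum_(j <= i < L.+1) a i n * U (Q (n - i)%N * r).
Proof.
move=> smopP QP jn size_r.
rewrite /banded mulr_suml linear_sum.
rewrite [RHS](big_nat_widenl j 0) // [RHS]big_mkcond /=.
apply: eq_bigr => i _; rewrite -scalerAl linearZ /=.
case: leqP => // ij; rewrite QP functional_pairing0 ?mulr0 //.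
by apply: leq_trans size_r _; lia.
Qed.

Lemma banded_pairing0 (R : realType) (U : {scalar {poly R}}) (L m : nat)
    (a : nat -> nat -> R) (P Q : nat -> {poly R}) (n : nat) (r : {poly R}) :
  smop (functional_form U) P -> (forall k, Q k = P (k + m)%N) ->
  (size r <= n - L + m)%N -> U (banded L a Q n * r) = 0.
Proof.
move=> smopP QP size_r; rewrite /banded mulr_suml linear_sum big_nat big1 //.
move=> i /andP[_ iL]; rewrite -scalerAl linearZ /= QP functional_pairing0 //.
  by rewrite mulr0.
by apply: leq_trans size_r _; lia.
Qed.

(** At most the term i = K remains, and it is present only when L = K; of [r] only the top
    coefficient then counts. *)
Lemma banded_pairing_last (R : realType) (U : {scalar {poly R}})
    (L K m : nat) (a : nat -> nat -> R) (P Q : nat -> {poly R}) (n : nat)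
    (r : {poly R}) :
  smop (functional_form U) P -> (forall k, Q k = P (k + m)%N) ->
  (L <= K <= n)%N -> (size r <= (n - K + m).+1)%N ->
  U (banded L a Q n * r) =
  if L == K then a K n * (r`_(n - K + m) * U (P (n - K + m)%N ^+ 2)) else 0.
Proof.
move=> smopP QP /andP[LK Kn] size_r.
rewrite (banded_pairing L a smopP QP Kn size_r).
case: eqVneq => [->|LK_neq]; last by rewrite big_geq // ltn_neqAle LK_neq.
by rewrite big_nat1 QP functional_pairing.
Qed.

(** * The Sobolev form and the polynomial F_n *)

Lemma Diter_eq0 (R : realType) (nu : step R) (m : nat) (p : {poly R}) :
  admissible nu -> (size p <= m)%N -> Diter nu m p = 0.
Proof.
move=> adm size_p; apply/eqP; rewrite -size_poly_leq0.
by apply: leq_trans (size_Diter m p adm) _; rewrite leqn0 subn_eq0.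
Qed.

Lemma sobolev_scalar (R : realType) (nu : step R) (m : nat) (lam : R)
    (U V : {scalar {poly R}}) (p : {poly R}) :
  scalar (sobolev nu m lam U V p).
Proof.
move=> c u v; rewrite /sobolev linearP !mulrDr -!scalerAr !linearP /=.
by ring.
Qed.

HB.instance Definition _ (R : realType) (nu : step R) (m : nat) (lam : R)
    (U V : {scalar {poly R}}) (p : {poly R}) :=
  GRing.isLinear.Build R {poly R} R *%R (sobolev nu m lam U V p)
    (sobolev_scalar nu m lam U V p).

Lemma sobolevC (R : realType) (nu : step R) (m : nat) (lam : R)
    (U V : {scalar {poly R}}) (p r : {poly R}) :
  sobolev nu m lam U V p r = sobolev nu m lam U V r p.
Proof. by rewrite /sobolev mulrC [Diter _ _ r * _]mulrC. Qed.

(** D^m kills degrees below m, so the form reduces there to that of [U]: P_n is orthogonal to all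
    lower S_k, and the band has width 0. *)
Lemma sobolev_smop_low (R : realType) (nu : step R) (m : nat) (lam : R)
    (U V : {scalar {poly R}}) (P S : nat -> {poly R}) (n : nat) :
  admissible nu -> smop (functional_form U) P ->
  smop (sobolev nu m lam U V) S -> (n < m)%N -> S n = P n.
Proof.
move=> adm smopP smopS nm.
have size_P := smop_size n smopP.
rewrite [RHS](smop_band (c := fun=> 0) (K := 0)
  (sobolev_scalar nu m lam U V) smopS _ size_P);
  rewrite ?big_geq ?addr0 //; first exact: smop_monic smopP.
- move=> k; rewrite addn0 => kn; rewrite sobolevC /sobolev.
  rewrite functional_pairing0 ?(smop_size k smopS) // add0r.
  by rewrite (Diter_eq0 adm) ?size_P // mul0r linear0 mulr0.
- by move=> j; case: j.
Qed.

Definition eta_scaled (R : realType) (nu : step R) (m : nat)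
    (a : nat -> nat -> R) (i n : nat) : R :=
  eta_nu nu m n * a i n / eta_nu nu m (n - i).

Lemma coef_array_eta_scaled (R : realType) (nu : step R) (m M : nat)
    (a : nat -> nat -> R) : admissible nu -> coef_array M a ->
  coef_array M (eta_scaled nu m a).
Proof.
move=> adm [a0 a_out]; split=> [n|i n iM ni]; rewrite /eta_scaled.
  by rewrite a0 subn0 mulr1 divff ?eta_nu_neq0.
by rewrite a_out // mulr0 mul0r.
Qed.

(** This is F_n; the index shift by [m] gives it degree n + m. *)
Definition sobolev_lhs (R : realType) (nu : step R) (m M : nat)
    (P : nat -> {poly R}) (a : nat -> nat -> R) (n : nat) : {poly R} :=
  banded M (eta_scaled nu m a) (fun k => P (k + m)%N) n.

Lemma Diter_sobolev_lhs (R : realType) (nu : step R) (m M : nat)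
    (P : nat -> {poly R}) (a : nat -> nat -> R) (n : nat) :
  Diter nu m (sobolev_lhs nu m M P a n) =
  eta_nu nu m n *: banded M a (Pder nu m P) n.
Proof.
rewrite /sobolev_lhs /banded linear_sum scaler_sumr; apply: eq_bigr => i _.
by rewrite linearZ /= /Pder !scalerA.
Qed.

Lemma sobolev_sobolev_lhs (R : realType) (nu : step R) (m M : nat) (lam : R)
    (U V : {scalar {poly R}}) (P : nat -> {poly R}) (a : nat -> nat -> R)
    (n : nat) (r : {poly R}) :
  let F := sobolev_lhs nu m M P a n in
  sobolev nu m lam U V r F =
  U (F * r)
  + lam * eta_nu nu m n * V (banded M a (Pder nu m P) n * Diter nu m r).
Proof.
rewrite /= sobolevC /sobolev Diter_sobolev_lhs -scalerAl linearZ /=.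
by rewrite mulrA.
Qed.

Lemma sobolev_lhs_monic (R : realType) (nu : step R) (m M : nat)
    (U : {scalar {poly R}}) (P : nat -> {poly R}) (a : nat -> nat -> R)
    (n : nat) :
  admissible nu -> coef_array M a -> smop (functional_form U) P ->
  let F := sobolev_lhs nu m M P a n in F \is monic /\ size F = (n + m).+1.
Proof.
move=> adm arr smopP; apply: banded_monic; first exact: coef_array_eta_scaled.
by move=> k; rewrite (smop_monic _ smopP) (smop_size _ smopP).
Qed.

(** * The coefficients c_{j,n} under coherence *)

(** The explicit formula is the Fourier coefficient of F_n along S_(n-j+m): in both pairings
    orthogonality removes the terms with i < j. The case j = 0 holds because F_n is monic. *)
Lemma sobolev_coefE (R : realType) (nu : step R) (m M N : nat) (lam : R)
    (U V : {scalar {poly R}}) (P Q S : nat -> {poly R})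
    (a b : nat -> nat -> R) (j n : nat) :
  let B := sobolev nu m lam U V in
  admissible nu -> coef_array M a -> smop (functional_form U) P ->
  smop (functional_form V) Q -> smop B S ->
  banded M a (Pder nu m P) n = banded N b Q n -> (j <= n)%N ->
  sobolev_coef nu m lam M N U V P Q S a b j n
    * B (S (n - j + m)%N) (S (n - j + m)%N) =
  B (S (n - j + m)%N) (sobolev_lhs nu m M P a n).
Proof.
move=> B adm arr smopP smopQ smopS coh jn.
have nz := smop_norm_neq0 (n - j + m)%N smopS.
rewrite /sobolev_coef; case: eqVneq => [j0|j_neq0].
  rewrite j0 subn0; have [mon sz] := sobolev_lhs_monic m n adm arr smopP.
  rewrite [RHS](smop_pairing (sobolev_scalar nu m lam U V) smopS) ?sz //.
  by move/monicP: mon; rewrite lead_coefE sz /= => ->.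
have size_S := smop_size (n - j + m)%N smopS.
rewrite jn mulrAC divfK // /B sobolev_sobolev_lhs coh.
rewrite (banded_pairing _ _ smopP (fun=> erefl) jn) ?size_S //.
rewrite (banded_pairing (m := 0) _ _ smopQ _ jn); last first.
- by apply: leq_trans (size_Diter _ _ adm) _; rewrite size_S; lia.
- by move=> k; rewrite addn0.
rewrite mulrDr; congr (_ + _); last by rewrite mulrCA mulrA.
by rewrite mulr_sumr; apply: eq_bigr => i _; rewrite /eta_scaled !mulrA.
Qed.

(** D^m lowers the degree of [r] by m, so the one bound on [r] suffices for the pairing with [U] and
    for that with [V]. *)
Lemma sobolev_lhs_orthogonal (R : realType) (nu : step R) (m M N : nat)
    (lam : R) (U V : {scalar {poly R}}) (P Q : nat -> {poly R})
    (a b : nat -> nat -> R) (n : nat) (r : {poly R}) :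
  admissible nu -> smop (functional_form U) P ->
  smop (functional_form V) Q ->
  banded M a (Pder nu m P) n = banded N b Q n ->
  (size r <= n - maxn M N + m)%N ->
  sobolev nu m lam U V r (sobolev_lhs nu m M P a n) = 0.
Proof.
move=> adm smopP smopQ coh size_r; rewrite sobolev_sobolev_lhs coh.
rewrite (banded_pairing0 _ smopP (fun=> erefl)); last first.
  by apply: leq_trans size_r _; lia.
rewrite (banded_pairing0 (m := 0) _ smopQ) ?mulr0 ?addr0 //.
  by move=> k; rewrite addn0.
apply: leq_trans (size_Diter _ _ adm) _.
by apply: leq_trans (leq_sub2r m size_r) _; lia.
Qed.

(** Pairing F_n with S_(n-K+m) leaves only the terms i = K: one from [U] if M = K and one from [V]
    if N = K. *)
Lemma sobolev_coef_last (R : realType) (nu : step R) (m M N K : nat) (lam : R)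
    (U V : {scalar {poly R}}) (P Q S : nat -> {poly R})
    (a b : nat -> nat -> R) (n : nat) :
  let B := sobolev nu m lam U V in
  admissible nu -> coef_array M a -> smop (functional_form U) P ->
  smop (functional_form V) Q -> smop B S ->
  banded M a (Pder nu m P) n = banded N b Q n ->
  (M <= K)%N -> (N <= K)%N -> (K <= n)%N ->
  (sobolev_coef nu m lam M N U V P Q S a b K n != 0) =
  ((if M == K then a K n * U (P (n - K + m)%N ^+ 2) else 0)
   + (if N == K then
        lam * eta_nu nu m (n - K) ^+ 2 * b K n * V (Q (n - K)%N ^+ 2)
      else 0) != 0).
Proof.
move=> B adm arr smopP smopQ smopS coh MK NK Kn.
have nz := smop_norm_neq0 (n - K + m)%N smopS.
have eta_nz k := eta_nu_neq0 m k adm.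
have size_S := smop_size (n - K + m)%N smopS.
have lead_S : (S (n - K + m)%N)`_(n - K + m) = 1.
  by have /monicP := smop_monic (n - K + m) smopS; rewrite lead_coefE size_S.
have := sobolev_coefE adm arr smopP smopQ smopS coh Kn.
rewrite sobolev_sobolev_lhs coh.
rewrite (banded_pairing_last (K := K) _ smopP (fun=> erefl)) ?MK ?size_S //.
rewrite (banded_pairing_last (K := K) (m := 0) _ smopQ) ?NK //; last first.
- by apply: leq_trans (size_Diter _ _ adm) _; rewrite size_S; lia.
- by move=> k; rewrite addn0.
rewrite addn0 coef_Diter ?size_S // lead_S mulr1 mul1r /eta_scaled.
set c := sobolev_coef _ _ _ _ _ _ _ _ _ _ _ _ _ _.
set X := (X in _ = (X != 0)) => cE.
(* Both terms contain eta_n / eta_(n-K). The [V] term comes with eta_n eta_(n-K), the second factor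
   being the leading coefficient of D^m S_(n-K+m); this is the origin of the square. *)
have : c * B (S (n - K + m)%N) (S (n - K + m)%N)
    = eta_nu nu m n / eta_nu nu m (n - K) * X.
  rewrite cE /X mulrDr; congr (_ + _); case: ifP => _; rewrite ?mulr0 //.
    by rewrite [RHS]mulrA; congr (_ * _); exact: mulrAC.
  by field.
move/(congr1 (fun x => x == 0)).
by rewrite !mulf_eq0 invr_eq0 (negbTE nz) !(negbTE (eta_nz _)) orbF /= => ->.
Qed.

(** * From the Sobolev relation back to coherence *)

Lemma coherence_orthogonal (R : realType) (nu : step R) (m M K : nat)
    (lam : R) (U V : {scalar {poly R}}) (P S : nat -> {poly R})
    (a c : nat -> nat -> R) (n : nat) (r : {poly R}) :
  admissible nu -> lam != 0 -> smop (functional_form U) P ->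
  smop (sobolev nu m lam U V) S -> (M <= K)%N ->
  sobolev_lhs nu m M P a n =
    S (n + m)%N + \sum_(1 <= j < K.+1) c j n *: S (n + m - j)%N ->
  (size r <= n - K)%N -> V (banded M a (Pder nu m P) n * r) = 0.
Proof.
move=> adm lam0 smopP smopS MK rel.
have size_Pder k := (Pder_monic m k adm (proj1 smopP)).2.
rewrite -[V _]/(functional_form V _ _).
apply: (linear_form_triangular0 size_Pder) => k k_lt.
have size_P := smop_size (k + m)%N smopP.
(* Every S_i in the expansion has i >= n + m - K > k + m, hence is orthogonal to P_(k+m). *)
have B0 i : (k + m < i)%N -> sobolev nu m lam U V (P (k + m)%N) (S i) = 0.
  move=> k_lt_i; rewrite sobolevC.
  rewrite (smop_pairing (sobolev_scalar nu m lam U V) smopS) ?size_P 1?ltnW //.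
  by rewrite nth_default ?mul0r ?size_P.
have := sobolev_sobolev_lhs nu m M lam U V P a n (P (k + m)%N).
rewrite /= rel linearD linear_sum /= B0; last by lia.
rewrite big_nat big1 => [|j /andP[_ jK]]; last first.
  by rewrite linearZ /= B0 ?mulr0 //; lia.
(* The [U] term vanishes because M <= K; what remains is the [V] term times the nonzero scalar lam
   eta_n. *)
rewrite -rel (banded_pairing0 _ smopP (fun=> erefl)); last first.
  by rewrite size_P; lia.
rewrite !add0r => /esym/eqP.
rewrite !mulf_eq0 (negbTE lam0) (negbTE (eta_nu_neq0 _ _ adm)) /= => /eqP E.
by rewrite /functional_form /Pder -scalerAr linearZ /= E mulr0.
Qed.

(** * Coherence and the Sobolev relation imply each other *)

Theorem theorem4p3 (R : realType) (nu : step R) (nu_adm : admissible nu)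
    (m : nat) (m_ge1 : (1 <= m)%N) (lam : R) (lam_gt0 : 0 < lam)
    (M N K : nat) (K_def : K = maxn M N)
    (U V : {scalar {poly R}}) (U_pos : posdef U) (V_pos : posdef V)
    (P Q S : nat -> {poly R})
    (P_smop : smop (functional_form U) P) (Q_smop : smop (functional_form V) Q)
    (S_smop : smop (sobolev nu m lam U V) S) :
  (forall a b : nat -> nat -> R,
     coherent_by nu m M N P Q a b ->
     let c := sobolev_coef nu m lam M N U V P Q S a b in
     [/\ forall n, (n < m)%N -> S n = P n,
         sobolev_relation nu m M K P S a c
       & forall n, (K <= n)%N ->
         [/\ (N < M)%N -> a M n != 0 -> c K n != 0,
             (M < N)%N -> b N n != 0 -> c K n != 0
           & M = N -> a M n * b N n != 0 ->
             (c K n != 0 <->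
              a K n * U (P (n - K + m)%N ^+ 2)
              + lam * eta_nu nu m (n - K) ^+ 2 * b K n * V (Q (n - K)%N ^+ 2)
              != 0)]])
  /\
  (forall a c : nat -> nat -> R,
     coef_array M a ->
     (forall j n, (1 <= j <= K)%N -> (n + m < j)%N -> c j n = 0) ->
     sobolev_relation nu m M K P S a c ->
     let b := coherence_coef nu m M V P Q a in
     coherence_relation nu m M K P Q a b /\
     ((forall n, (K <= n)%N -> b K n != 0) ->
      (forall n, (M <= n)%N -> a M n != 0) ->
      coherent_pair nu m M K U V)).
Proof.
have linB := sobolev_scalar nu m lam U V.
have MK : (M <= K)%N by rewrite K_def leq_maxl.
have NK : (N <= K)%N by rewrite K_def leq_maxr.
have lhsE a n : coef_array M a ->
    P (n + m)%N + \sum_(1 <= i < M.+1)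
      (eta_nu nu m n * a i n / eta_nu nu m (n - i)) *: P (n - i + m)%N
    = sobolev_lhs nu m M P a n.
  by move=> arr; rewrite /sobolev_lhs bandedE //; exact: coef_array_eta_scaled.
split=> [a b [arr_a arr_b _ _ coh] c|a c arr_a _ rel b].
  have cohE n : banded M a (Pder nu m P) n = banded N b Q n.
    by rewrite !bandedE.
  split=> [n nm|n|n Kn]; first exact: sobolev_smop_low nu_adm P_smop S_smop nm.
    have [mon sz] := sobolev_lhs_monic m n nu_adm arr_a P_smop.
    rewrite lhsE //; apply: (smop_band (c := c^~ n) linB S_smop mon sz).
    - move=> k k_lt; apply: sobolev_lhs_orthogonal (cohE n) _ => //.
      by rewrite (smop_size k S_smop) -K_def; lia.
    - move=> j _ j_le; case: (leqP j n) => jn.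
        rewrite -addnBAC //; exact: sobolev_coefE.
      (* For n < j <= n + m the coefficient is 0 by definition, and F_n is indeed orthogonal to
         S_(n+m-j), whose degree is below m. *)
      have -> : c j n = 0.
        by rewrite /c /sobolev_coef leqNgt jn /=; case: eqP jn => // ->.
      rewrite mul0r (sobolev_lhs_orthogonal _ _ P_smop Q_smop (cohE n)) //.
      by rewrite (smop_size _ S_smop); lia.
    - move=> j /andP[j_gt0 _] j_gt; rewrite /c /sobolev_coef.
      by rewrite (gtn_eqF j_gt0) leqNgt (leq_ltn_trans (leq_addr m n) j_gt).
  have cK :=
    sobolev_coef_last nu_adm arr_a P_smop Q_smop S_smop (cohE n) MK NK Kn.
  have normP k : U (P k ^+ 2) != 0 := smop_norm_neq0 k P_smop.
  have normQ k : V (Q k ^+ 2) != 0 := smop_norm_neq0 k Q_smop.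
  (* Unequal widths leave a single term, a product of nonzero factors; equal widths leave both,
     which is the criterion (iii). *)
  rewrite /c; split=> [NM aM|MN bN|MN _].
  - have KM : K = M by rewrite K_def; lia.
    by rewrite cK KM eqxx (ltn_eqF NM) addr0 mulf_neq0.
  - have KN : K = N by rewrite K_def; lia.
    rewrite cK KN eqxx (ltn_eqF MN) add0r !mulf_neq0 ?expf_neq0 ?eta_nu_neq0 //.
    by rewrite gt_eqF.
  - have KM : M = K by rewrite K_def; lia.
    by rewrite cK -MN KM eqxx.
have cohr : coherence_relation nu m M K P Q a b.
  move=> n; rewrite -bandedE //.
  have [|mon sz] := banded_monic (m := 0) (Q := Pder nu m P) n arr_a.
    by move=> k; rewrite addn0; apply: Pder_monic => //; case: P_smop.
  rewrite addn0 in sz.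
  (* G_n is monic of degree n and orthogonal to Q_k for k + K < n, so its expansion in the Q_k has
     width K, and [b] holds its Fourier coefficients. *)
  apply: (smop_band (c := b^~ n) (functional_form_scalar V) Q_smop mon sz).
  - move=> k k_lt; rewrite /functional_form mulrC.
    apply: (coherence_orthogonal nu_adm _ P_smop S_smop MK (c := c)).
    + by rewrite gt_eqF.
    + by rewrite -lhsE.
    + by rewrite (smop_size k Q_smop); lia.
  - move=> j /andP[j_gt0 _] jn.
    rewrite /b /coherence_coef (gtn_eqF j_gt0) jn -bandedE //.
    by rewrite divfK ?(smop_norm_neq0 _ Q_smop) // /functional_form mulrC.
  - move=> j /andP[j_gt0 _] nj.
    by rewrite /b /coherence_coef (gtn_eqF j_gt0) leqNgt nj.
split=> // bK aM; exists P, Q, a, b; split=> //; split=> //.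
split=> // i n _ ni; rewrite /b /coherence_coef leqNgt ni /=.
by case: eqP ni => // ->.
Qed.
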